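(* Let $p$ be a prime and let $F$ be a finite-dimensional $\mathbb F_p$-vector space with a direct decomposition $F=\bigoplus_{i=1}^n U_i$ into subspaces. Suppose that $(F,+,*_i)$, $i=1,\dots,n$, are non-associative algebras (all with additive group $F$) and $A_1,\dots,A_n\subseteq F$ are additive subgroups such that the set $\{( *_i,A_i)\}$ is compatible and $\dim_{\mathbb F_p}A_i+\dim_{\mathbb F_p}U_i=\dim_{\mathbb F_p}F$ for each $i$. If, for each $i$, $f_i\colon F\to U_i$ is any $\mathbb F_p$-linear map with $\ker(f_i)=A_i$, then $$x\circ y=\sum_{i} f_i(x*_iy)$$ defines a presemifield on $F$.
   Context: All algebras are finite. A non-associative algebra $(F,+,* )$ means an abelian group $(F,+)$ with a (not necessarily associative) multiplication satisfying both distributive laws. A presemifield is such a finite algebra in which $x*y=0$ implies $x=0$ or $y=0$. Given non-associative algebras $(F,+,*_i)$, $i=1,\dots,n$, with the same additive group $F$, and additive subgroups $A_i\subseteq F$, the set $\{( *_i,A_i)\}$ is called compatible if, whenever $x,y\in F$ satisfy $x*_iy\in A_i$ for all $i=1,\dots,n$, then $x=0$ or $y=0$. *)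

(* Defs.v *)
From mathcomp Require Import all_boot all_order all_algebra all_field.

Set Implicit Arguments.
Unset Strict Implicit.
Unset Printing Implicit Defensive.

Import GRing.Theory.
Local Open Scope ring_scope.

Definition nonassoc_algebra (F : zmodType) (mul : F -> F -> F) : Prop :=
  left_distributive mul +%R /\ right_distributive mul +%R.

Definition presemifield (F : zmodType) (mul : F -> F -> F) : Prop :=
  [/\ exists s : seq F, forall x : F, x \in s,
      nonassoc_algebra mul
    & forall x y : F, mul x y = 0 -> x = 0 \/ y = 0].

Definition compatible (F : zmodType) (n : nat)
    (mul : 'I_n -> F -> F -> F) (A : 'I_n -> {pred F}) : Prop :=
  forall x y : F, (forall i : 'I_n, mul i x y \in A i) -> x = 0 \/ y = 0.

(* An additive subgroup of a vector space over a prime field is a subspace,   *)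
(* hence equals its linear span; [finvect_type] makes the span of a predicate *)
(* available, as it equips the space with its finite type structure.          *)
Definition dim_subgroup (p : nat) (F : vectType 'F_p) (A : {pred F}) : nat :=
  \dim (<<(enum (A : {pred finvect_type F}) : seq F)>>%VS : {vspace F}).

(* Main.v *)
Require Import Defs.
From mathcomp Require Import all_boot all_order all_algebra all_field.

Set Implicit Arguments.
Unset Strict Implicit.
Unset Printing Implicit Defensive.

Import GRing.Theory.
Local Open Scope ring_scope.

(** Since the sum of the [U i] is direct, a sum of vectors [f i (mul i x y)],
    one from each [U i], vanishes only if every one of them does.  As the kernel
    of [f i] is [A i], this says that [mul i x y] lies in [A i] for all [i],
    and compatibility then forces [x = 0] or [y = 0].  Distributivity is
    inherited because each [f i] is additive. *)

Theorem proposition2p2 (p : nat) (p_pr : prime p) (F : vectType 'F_p) (n : nat)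
  (U : 'I_n -> {vspace F})
  (U_direct : directv (\sum_(i < n) U i)%VS)
  (U_full : (\sum_(i < n) U i)%VS = fullv)
  (mul : 'I_n -> F -> F -> F)
  (mul_alg : forall i : 'I_n, nonassoc_algebra (mul i))
  (A : 'I_n -> {pred F})
  (A_subgroup : forall i : 'I_n, zmod_closed (A i))
  (mulA_compat : compatible mul A)
  (dimAU : forall i : 'I_n, (dim_subgroup (A i) + \dim (U i))%N = \dim {: F})
  (f : forall i : 'I_n, 'Hom(F, subvs_of (U i)))
  (ker_f : forall i : 'I_n, lker (f i) =i A i) :
  presemifield (fun x y : F => \sum_(i < n) vsval (f i (mul i x y))).
Proof.
split.
- (* A finite-dimensional space over a finite field is finite. *)
  exists (enum (finvect_type F)) => x.
  by have := mem_enum (finvect_type F) x; rewrite inE.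
- split=> x y z; rewrite -big_split; apply: eq_bigr => i _ /=.
    by rewrite (proj1 (mul_alg i)) !linearD.
  by rewrite (proj2 (mul_alg i)) !linearD.
- move=> x y sum0; apply: mulA_compat => i.
  rewrite -ker_f memv_ker; apply/eqP/val_inj.
  have /directv_sum_independent indepU := U_direct.
  by rewrite [LHS](indepU _ _ sum0) ?raddf0 // => k _; apply: subvsP.
Qed.
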